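(* Let $k \geq 4$ be a fixed integer. There is a constant $a_k$ depending only on $k$ such that for every finite projective plane $\Pi$ of order $n$ with $n \geq k$, the Levi graph $\Gamma_{\Pi}$ satisfies $$c_{2k}(\Gamma_{\Pi}) > \frac{1}{2k}N_{(k)} - \frac{1}{2}(n-1)N_{(k-1)} - \frac{(k-1)(k-2)}{2k}N_{(k-1)} - a_k n^{2k-2}.$$
   Context: $N = n^2+n+1$; for a positive integer $x$, $x_{(m)} = x(x-1)\cdots(x-m+1)$. The Levi graph $\Gamma_{\Pi}$ is the bipartite graph whose vertex classes are the points and the lines of $\Pi$, a point adjacent to a line iff it lies on it. $c_{2k}(\Gamma_{\Pi})$ is the number of cycles of length $2k$ in $\Gamma_{\Pi}$. *)

(* Defs.v *)
From HB Require Import structures.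
From mathcomp Require Import all_boot all_order all_algebra.
From mathcomp Require Import reals.

Set Implicit Arguments.
Unset Strict Implicit.
Unset Printing Implicit Defensive.

Record projective_plane := ProjectivePlane {
  point : finType;
  line : finType;
  incident : point -> line -> bool;
  line_through : forall p q : point, p <> q ->
    exists! l : line, incident p l /\ incident q l;
  meeting_point : forall l m : line, l <> m ->
    exists! p : point, incident p l /\ incident p m;
  (* nondegeneracy: four points, no three of them on a common line *)
  quadrangle : exists Q : {set point}, #|Q| = 4 /\
    forall l : line, #|[set p in Q | incident p l]| <= 2
}.

Definition has_order (Pi : projective_plane) (n : nat) : Prop :=
  forall l : line Pi, #|[set p : point Pi | incident p l]| = n.+1.

Definition levi_graph (Pi : projective_plane) : rel (point Pi + line Pi) :=
  fun u v =>
    match u, v with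
    | inl p, inr l => incident p l
    | inr l, inl p => incident p l
    | _, _ => false
    end.

Lemma levi_graph_sym Pi : symmetric (@levi_graph Pi).
Proof. by move=> [p|l] [q|m]. Qed.

Lemma levi_graph_irrefl Pi : irreflexive (@levi_graph Pi).
Proof. by case. Qed.

(* The edge set of the closed walk along s, an edge xy being the pair {x, y}. *)
Definition cycle_edges (T : finType) (s : seq T) : {set {set T}} :=
  [set [set x; next s x] | x in s].

(* A cycle is counted as a subgraph, which is determined by its edge set, so
   that rotating or reversing the sequence of its vertices gives the same
   cycle. The guard excludes an edge traversed back and forth. *)
Definition cycles (T : finType) (e : rel T) (m : nat) : {set {set {set T}}} :=
  [set E | (2 < m) &&
     [exists s : m.-tuple T, ucycleb e s && (E == cycle_edges s)]].

Definition num_cycles (T : finType) (e : rel T) (m : nat) : nat :=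
  #|cycles e m|.

(* Main.v *)
Require Import Defs.
From mathcomp Require Import all_boot all_order all_algebra.
From mathcomp Require Import reals.
From mathcomp Require Import zify ring lra.
Import Order.TTheory GRing.Theory Num.Theory.

Set Implicit Arguments.
Unset Strict Implicit.
Unset Printing Implicit Defensive.

(** A 2k-cycle of the Levi graph is a k-gon: a cyclic sequence of k distinct
    points whose k consecutive joining lines are distinct. Each cycle comes from
    at most 2k such sequences, one for each choice of a first edge, so it
    suffices to bound the sequences of k distinct points for which two sides
    coincide. If two adjacent sides coincide, three consecutive points are
    collinear, which happens for at most [k (n + 1) N^(k-1)] sequences; if two
    non-adjacent sides coincide, four points are collinear, which happens for
    [O(n^(2k-2))] sequences. Up to [O(n^(2k-2))] the former count is
    [k (n - 1) N_(k-1)], and the third term of the claimed bound has the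
    favourable sign. *)

(** * Counting by fibres and falling factorials *)

Lemma leq_card_fibers (A B : finType) (S : {set A}) (Y : {set B}) (h : A -> B)
    (M : nat) :
  (forall x, x \in S -> h x \in Y) ->
  (forall x, x \in S -> #|[set z in S | h z == h x]| <= M) ->
  #|S| <= M * #|Y|.
Proof.
move=> hY hM; rewrite -sum1_card (partition_big h (mem Y)) //=.
rewrite mulnC -sum_nat_const; apply: leq_sum => y _.
have [/existsP[x /andP[xS /eqP <-]]|/existsPn no] :=
  boolP [exists x, (x \in S) && (h x == y)].
  by apply: leq_trans (hM x xS); rewrite -sum1dep_card.
by rewrite big_pred0 // => x; apply/negbTE/no.
Qed.

Lemma leq_card_bigcup (I T : finType) (F : I -> {set T}) :
  #|\bigcup_i F i| <= \sum_i #|F i|.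
Proof.
elim/big_ind2: _ => [|A m B n leA leB|//]; first by rewrite cards0.
by apply: leq_trans (leq_add leA leB); rewrite cardsU leq_subr.
Qed.

Lemma leq_ffact_exp (N m : nat) : N ^_ m <= N ^ m.
Proof.
elim: m => // m IH; rewrite ffactnSr expnSr.
by apply: leq_mul => //; apply: leq_subr.
Qed.

(** Induction on [m]: bound one factor [N] by [(N - m.+1) + m.+1]. The first summand extends the
    falling factorial, the second costs at most [m.+1 * N ^ m.+1], and
    [m.+1 ^ 2 + m.+1 <= m.+2 ^ 2]. *)
Lemma leq_exp_ffact (N m : nat) : N ^ m.+1 <= N ^_ m.+1 + m.+1 ^ 2 * N ^ m.
Proof.
elim: m => [|m IH]; first by rewrite expn1 ffactn1 leq_addr.
have h1 : N * N ^_ m.+1 <= N ^_ m.+2 + m.+1 * N ^ m.+1.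
  have le_N : N <= (N - m.+1) + m.+1 by lia.
  rewrite (ffactnSr N m.+1); apply: leq_trans (leq_mul le_N (leqnn _)) _.
  by rewrite mulnDl mulnC leq_add2l leq_mul2l leq_ffact_exp orbT.
have h2 := leq_mul (leqnn N) IH.
rewrite mulnDr (mulnCA N) -!expnS in h2; apply: leq_trans h2 _.
by move: h1; move: (N * _ ^_ _) (N ^_ m.+2) (N ^ m.+1) => a b c; nia.
Qed.

(** * Cycles and their edge sets *)

Lemma next_neq (T : eqType) (s : seq T) (u : T) :
  uniq s -> 2 < size s -> u \in s ->
  next s u != u /\ next s (next s u) != u.
Proof.
move=> Us sz /rot_to[i p def_p]; rewrite -!(next_rot i Us).
move: Us sz; rewrite -(rot_uniq i) -(size_rot i) def_p.
case: p {def_p} => [|a [|b p]] //=; rewrite !inE !negb_or eqxx.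
case/and3P=> /and3P[ua ub _] /andP[ab _] _ _.
by rewrite eq_sym ua /= (negbTE ua) eqxx eq_sym ub.
Qed.

(** Reduces comparing two cyclic sequences to comparing the orbits of their heads under [next]. *)
Lemma uniq_traject_next (T : eqType) (x : T) (p : seq T) :
  uniq (x :: p) -> x :: p = traject (next (x :: p)) x (size p).+1.
Proof.
move=> U; have := cycle_next U; rewrite /cycle rcons_path => /andP[/fpathE + _].
by rewrite trajectS => <-.
Qed.

(* A walk around a cycle never turns back, so at each vertex the edge already
   used determines the other one. *)
Lemma cycle_edges_inj (T : finType) (x y : T) (r r' : seq T) :
  uniq [:: x, y & r] -> uniq [:: x, y & r'] -> 0 < size r ->
  size r = size r' ->
  cycle_edges [:: x, y & r] = cycle_edges [:: x, y & r'] -> r = r'.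
Proof.
set s := [:: x, y & r]; set s' := [:: x, y & r'] => Us Us' r0 szr eqE.
have sz : 2 < size s by [].
have sz' : 2 < size s' by rewrite /= -szr.
have step i : iter i (next s) x \in s /\ iter i (next s) x \in s' /\
    iter i.+1 (next s) x = next s' (iter i (next s) x).
  elim: i => [|i [us [us' eqv]]]; first by rewrite /= !inE !eqxx.
  rewrite [iter i.+2 _ _]iterS.
  set u := iter i _ x in us us' eqv *; set v := iter i.+1 _ x in eqv *.
  have eqv' : next s u = v by [].
  have vs : v \in s by rewrite -eqv' mem_next.
  have vs' : v \in s' by rewrite eqv mem_next.
  split=> //; split=> //.
  have [uv wu] := next_neq Us sz us; rewrite eqv' in uv wu.
  have [wv _] := next_neq Us sz vs.
  have : [set v; next s v] \in cycle_edges s'.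
    by rewrite -eqE; apply/imsetP; exists v.
  move: (next s v) wu wv => w wu wv /imsetP[z zs' eqz].
  have vz : v \in [set z; next s' z] by rewrite -eqz set21.
  have wz : w \in [set z; next s' z] by rewrite -eqz set22.
  (* The edge from [v] to [w] is also an edge of [s']. If it is the one leaving [v] there, the
     successors agree; if it is the one entering [v], it starts at [u], but [w] is neither [u] nor
     [v]. *)
  move: vz wz; rewrite !inE => /orP[/eqP <-|/eqP vz].
    by rewrite (negbTE wv) => /eqP.
  have -> : z = u by apply: (can_inj (prev_next Us')); rewrite -vz -eqv.
  by rewrite -eqv (negbTE wu) (negbTE wv).
have it i : iter i (next s) x = iter i (next s') x.
  by elim: i => // i IH; have [_ [_ ->]] := step i; rewrite iterS -IH.
suff : s = s' by case.
rewrite /s /s' (uniq_traject_next Us) (uniq_traject_next Us') /= -szr.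
apply: (@eq_from_nth _ x); first by rewrite /= !size_traject.
move=> i; rewrite -/s -/s' -!trajectS size_traject => lti.
by rewrite !nth_traject.
Qed.

(** * Lines and points of the plane *)

(** [l0] is only a default; for distinct points the value is their unique joining line. *)
Definition line_of (Pi : projective_plane) (l0 : line Pi) (p q : point Pi) :=
  odflt l0 [pick l | incident p l && incident q l].

Lemma line_ofP (Pi : projective_plane) (l0 : line Pi) (p q : point Pi) :
  p != q ->
  incident p (line_of l0 p q) /\ incident q (line_of l0 p q).
Proof.
move=> /eqP /(@line_through Pi)[l [[pl ql] _]]; rewrite /line_of.
by case: pickP => [m /andP[] //|/(_ l)]; rewrite pl ql.
Qed.

Lemma line_of_unique (Pi : projective_plane) (l0 l : line Pi) (p q : point Pi) :
  p != q -> incident p l -> incident q l -> line_of l0 p q = l.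
Proof.
move=> pq pl ql; have [pm qm] := line_ofP l0 pq.
have [m [_ U]] := line_through (elimN eqP pq).
by rewrite -(U l) // -(U (line_of _ _ _)).
Qed.

(** The line joining two points of the quadrangle misses one of the four. This also supplies the
    default line for [line_of]. *)
Lemma ex_nonincident (Pi : projective_plane) :
  exists (p : point Pi) (l : line Pi), ~~ incident p l.
Proof.
have [Q [Q4 Ql]] := quadrangle Pi.
have /card_gt1P[p [q [_ _ /eqP pq]]] : 1 < #|Q| by rewrite Q4.
have [l _] := line_through pq.
have /subsetPn[x xQ] : ~~ (Q \subset [set p in Q | incident p l]).
  by apply/negP=> /subset_leq_card; rewrite Q4; have := Ql l; lia.
by rewrite inE xQ /= => xl; exists x, l.
Qed.

(* Projecting from a point off a line onto that line, each fibre is a line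
   with the centre removed. *)
Lemma card_points (Pi : projective_plane) (n : nat) :
  has_order Pi n -> #|point Pi| = n ^ 2 + n + 1.
Proof.
move=> ord; have [p0 [l p0l]] := ex_nonincident Pi.
pose L := line_of l p0.
pose h q := odflt p0 [pick x | incident x l && incident x (L q)].
have neq0 x : incident x l -> p0 != x by apply: contraTneq => <-.
have hP q : p0 != q -> incident (h q) l /\ incident (h q) (L q).
  move=> q0; rewrite /h; have [p0L _] := line_ofP l q0.
  have lL : l <> L q by move=> eqL; rewrite eqL p0L in p0l.
  have [x [[xl xL] _]] := meeting_point lL.
  by case: pickP => [y /andP[] //|/(_ x)]; rewrite xl xL.
rewrite -cardsT (cardsD1 p0) inE addnC; congr (_ + _).
rewrite -sum1_card (partition_big h (mem [set x | incident x l])) /=; last first.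
  by move=> q; rewrite !inE andbT eq_sym => /hP[].
rewrite (eq_bigr (fun=> n)) => [|x]; first by rewrite sum_nat_const ord; lia.
rewrite inE => xl; have [p0L xL] := line_ofP l (neq0 x xl).
have := ord (L x); rewrite (cardsD1 p0) inE p0L => -[<-].
rewrite -sum1dep_card; apply: eq_bigl => q; rewrite !inE andbT [q == p0]eq_sym.
have [//|q0] /= := eqVneq p0 q; have [hl hL] := hP q q0.
have [p0q qL] := line_ofP l q0.
apply/eqP/idP => [eqx|qLx].
  by rewrite /L (@line_of_unique _ _ (L q)) ?neq0 -?eqx.
(* If [h q] and [x] differed, [L q = L x] would share two points with [l], hence equal [l] and put
   [p0] on it. *)
apply/eqP; apply: contraNT p0l => hx.
have eqL : L q = L x by apply: line_of_unique.
by rewrite -(@line_of_unique _ l l _ _ hx) // (@line_of_unique _ _ (L x)) -?eqL // eqL.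
Qed.

(** * Tuples with collinear entries *)

(** The entries outside [D], among them those at [a] and [b], already fix the line; each entry at a
    position of [D] then has [n.+1] choices on it. *)
Lemma card_tuples_on_line (Pi : projective_plane) (n k : nat) (l0 : line Pi)
    (S : {set k.-tuple (point Pi)}) (a b : 'I_k) (D : {set 'I_k}) :
  has_order Pi n -> a \notin D -> b \notin D ->
  (forall t d, t \in S -> d \in D ->
     incident (tnth t d) (line_of l0 (tnth t a) (tnth t b))) ->
  #|S| <= n.+1 ^ #|D| * #|point Pi| ^ (k - #|D|).
Proof.
move=> ord aD bD onL; have [->|[t0 t0S]] := set_0Vmem S; first by rewrite cards0.
pose p0 := tnth t0 a.
(* [off] forgets the entries on [D] and [on] keeps only those, with [p0] as filler; [on] is
   injective on each fibre of [off]. *)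
pose off (t : k.-tuple (point Pi)) := [ffun i => if i \in D then p0 else tnth t i].
pose on (t : k.-tuple (point Pi)) := [ffun i => if i \in D then tnth t i else p0].
have -> : #|point Pi| ^ (k - #|D|) = #|[set f in pffun_on p0 (mem (~: D)) predT]|.
  rewrite cardsE card_pffun_on; congr (_ ^ _).
  by have := cardsC D; rewrite card_ord; move: #|D| #|~: D| => x y; lia.
apply: (leq_card_fibers (h := off)) => [t _|t tS].
  rewrite inE; apply/pffun_onP; split=> //; apply/subsetP=> i.
  by rewrite !inE ffunE; case: ifP; rewrite ?eqxx.
have agree z i : off z = off t -> i \notin D -> tnth z i = tnth t i.
  by move=> /ffunP/(_ i); rewrite !ffunE => + /negbTE iD; rewrite iD.
rewrite -(ord (line_of l0 (tnth t a) (tnth t b))) -(card_pffun_on p0 (mem D)).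
rewrite -[X in _ <= X]cardsE.
rewrite -(card_in_imset (f := on)) => [|z w]; last first.
  rewrite !inE => /andP[_ /eqP zt] /andP[_ /eqP wt] /ffunP eqon.
  apply: eq_from_tnth => i; have := eqon i; rewrite !ffunE.
  by have [//|iD _] := boolP (i \in D); rewrite !agree.
apply/subset_leq_card/subsetP=> _ /imsetP[z + ->].
rewrite !inE => /andP[zS /eqP zt]; apply/pffun_onP; split.
  by apply/subsetP=> i; rewrite !inE ffunE; case: ifP; rewrite ?eqxx.
move=> _ /imageP[i iD ->]; rewrite inE ffunE iD.
by rewrite -(agree z a) // -(agree z b) //; apply: onL.
Qed.

(** * Polygons and cycles of the Levi graph *)

(** [p0] is the starting vertex, carried along so that the last line closes the polygon. *)
Fixpoint levi_walk (Pi : projective_plane) (l0 : line Pi) (p0 p : point Pi)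
    (r : seq (point Pi)) : seq (point Pi + line Pi) :=
  if r is q :: r' then [:: inl p, inr (line_of l0 p q) & levi_walk l0 p0 q r']
  else [:: inl p; inr (line_of l0 p p0)].

Definition polygon_walk (Pi : projective_plane) (l0 : line Pi)
    (s : seq (point Pi)) : seq (point Pi + line Pi) :=
  if s is p :: r then levi_walk l0 p p r else [::].

Definition sides (Pi : projective_plane) (l0 : line Pi)
    (s : seq (point Pi)) : seq (line Pi) :=
  if s is p :: r then pairmap (line_of l0) p (rcons r p) else [::].

Lemma size_polygon_walk (Pi : projective_plane) (l0 : line Pi) s :
  size (polygon_walk l0 s) = 2 * size s.
Proof.
by case: s => //= p r; elim: r {2}p => //= q r IH p'; rewrite IH; lia.
Qed.

Lemma polygon_walk_points (Pi : projective_plane) (l0 : line Pi) s :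
  pmap (fun v => if v is inl p then Some p else None) (polygon_walk l0 s) = s.
Proof. by case: s => //= p r; elim: r {2 3}p => //= q r IH p'; rewrite IH. Qed.

Lemma polygon_walk_uniq (Pi : projective_plane) (l0 : line Pi) s :
  uniq (polygon_walk l0 s) = uniq s && uniq (sides l0 s).
Proof.
case: s => // p0 r; rewrite /polygon_walk /sides.
have memP p s q : (inl q \in levi_walk l0 p0 p s) = (q \in p :: s).
  by elim: s p => [|q' s IH] p; rewrite /= !inE ?IH ?inE //; apply: orbF.
have memL p s l : (inr l \in levi_walk l0 p0 p s) =
    (l \in pairmap (line_of l0) p (rcons s p0)).
  by elim: s p => [|q' s IH] p; rewrite /= !inE ?IH.
elim: r {2 3 4}p0 => //= q r IH p; rewrite inE memP memL IH /=.
by case: (p \notin _); case: (q \notin r); case: (uniq r); rewrite /= ?andbF.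
Qed.

Lemma polygon_walk_cycle (Pi : projective_plane) (l0 : line Pi) s :
  1 < size s -> uniq s -> cycle (@levi_graph Pi) (polygon_walk l0 s).
Proof.
case: s => // p0 r r0 U.
(* Consecutive vertices differ, the closing pair included, so each [line_of] is a genuine joining
   line. *)
have : path (fun x y => x != y) p0 (rcons r p0).
  rewrite rcons_path; apply/andP; split.
    by apply: (@pairwise_sorted _ _ (p0 :: r)); rewrite -uniq_pairwise.
  case/lastP: r r0 U => // r x _ /=; rewrite last_rcons mem_rcons inE.
  by rewrite negb_or eq_sym => /andP[/andP[]].
rewrite /polygon_walk.
have -> : cycle (@levi_graph Pi) (levi_walk l0 p0 p0 r) =
  path (@levi_graph Pi) (inl p0) (rcons (behead (levi_walk l0 p0 p0 r)) (inl p0)).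
  by case: (r).
elim: r {1 3 5}p0 {r0 U} => /= [|q r IH] p.
  by rewrite andbT => /(line_ofP l0)[-> ->].
case/andP=> /(line_ofP l0)[-> qL] /IH.
by case: r {IH} => [|q' r] /=; rewrite qL.
Qed.

(** The cyclic successor [ordS] makes the closing side an ordinary one. *)
Definition tside (Pi : projective_plane) (l0 : line Pi) (k : nat)
    (t : k.-tuple (point Pi)) (i : 'I_k) :=
  line_of l0 (tnth t i) (tnth t (ordS i)).

Lemma nth_sides (Pi : projective_plane) (l0 : line Pi) (k : nat)
    (t : k.-tuple (point Pi)) (i : 'I_k) :
  nth l0 (sides l0 t) i = tside l0 t i.
Proof.
case: k t i => [|k] t i; first by case: i.
case/tupleP: t => p r; rewrite /tside !(tnth_nth p) /=.
rewrite (nth_pairmap p) ?size_rcons ?size_tuple // -rcons_cons !nth_rcons /=.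
rewrite size_tuple ltn_ord; have := ltn_ord i; rewrite ltnS leq_eqVlt.
case/orP=> [/eqP ->|ik]; first by rewrite ltnn eqxx modnn.
by rewrite ik modn_small.
Qed.

Definition polygons (Pi : projective_plane) (l0 : line Pi) (k : nat) :=
  [set t : k.-tuple (point Pi) | uniq t & uniq (sides l0 t)].

(* A polygon is recovered from its cycle together with its first edge. *)
Lemma card_polygons_cycles (Pi : projective_plane) (l0 : line Pi) (k : nat) :
  1 < k -> #|polygons l0 k| <= 2 * k * num_cycles (@levi_graph Pi) (2 * k).
Proof.
move=> k1; apply: (leq_card_fibers
  (h := fun t : k.-tuple (point Pi) => cycle_edges (polygon_walk l0 t))).
  move=> t; rewrite !inE => /andP[Ut Us].
  have -> /= : 2 < 2 * k by lia.
  have sz : size (polygon_walk l0 t) == 2 * k.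
    by rewrite size_polygon_walk size_tuple.
  apply/existsP; exists (Tuple sz); rewrite /= eqxx andbT /ucycleb.
  by rewrite polygon_walk_cycle ?size_tuple // polygon_walk_uniq Ut.
move=> t tP; set E := cycle_edges _.
have leE : #|E| <= 2 * k.
  apply: leq_trans (leq_imset_card _ _) _; apply: leq_trans (card_size _) _.
  by rewrite size_polygon_walk size_tuple.
apply: leq_trans leE.
(* This edge is an unordered pair, but its point and its line lie in different summands, so it
   determines the first two entries of the walk. *)
pose edge1 (z : k.-tuple (point Pi)) :=
  let w := polygon_walk l0 z in [set nth (inr l0) w 0; nth (inr l0) w 1].
have walkE (z : k.-tuple (point Pi)) : exists p l r,
    polygon_walk l0 z = [:: inl p, inr l & r].
  case: z => -[|p [|q r]] /= zk; first by move: zk k1; case: (k).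
    by exists p, (line_of l0 p p), [::].
  by exists p, (line_of l0 p q), (levi_walk l0 p q r).
rewrite -(card_in_imset (f := edge1)) => [|z w]; last first.
  rewrite !inE => /andP[/andP[Uz Usz] /eqP zE] /andP[/andP[Uw Usw] /eqP wE].
  rewrite /edge1 => eq1; apply: val_inj => /=.
  rewrite -(polygon_walk_points l0 z) -(polygon_walk_points l0 w).
  congr (pmap _ _).
  have Wz : uniq (polygon_walk l0 z) by rewrite polygon_walk_uniq Uz.
  have Ww : uniq (polygon_walk l0 w) by rewrite polygon_walk_uniq Uw.
  have sz := size_polygon_walk l0 z; have sw := size_polygon_walk l0 w.
  have eqE := etrans zE (esym wE); move: eq1 Wz Ww sz sw eqE; rewrite !size_tuple.
  have [p [l [r ->]]] := walkE z; have [p' [l' [r' ->]]] := walkE w => /= eq1.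
  have : inl p \in [set inl p'; inr l'] by rewrite -eq1 set21.
  have : inr l \in [set inl p'; inr l'] by rewrite -eq1 set22.
  rewrite !inE => /eqP[<-]; rewrite orbF => /eqP[<-] Wz Ww sz sw eqE.
  have r0 : 0 < size r by move: k1 sz; clear; lia.
  have rr' : size r = size r' by move: sz sw; clear; lia.
  by rewrite (cycle_edges_inj Wz Ww r0 rr' eqE).
apply/subset_leq_card/subsetP=> _ /imsetP[z + ->].
rewrite !inE => /andP[/andP[Uz Usz] /eqP zE]; rewrite -zE /edge1.
have [p [l [r ->]]] := walkE z; apply/imsetP; exists (inl p).
  by rewrite inE eqxx.
by rewrite /= eqxx.
Qed.

(** * Tuples of distinct points that are not polygons *)

(** A union bound: each of the [k] adjacent pairs of sides confines one position to a line, each of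
    the at most [k * k] other pairs confines two. *)
Lemma card_uniq_tuples_polygons (Pi : projective_plane) (l0 : line Pi)
    (n k : nat) :
  has_order Pi n -> 2 < k ->
  #|point Pi| ^_ k <= #|polygons l0 k|
    + k * (n.+1 * #|point Pi| ^ (k - 1))
    + k * (k * (n.+1 ^ 2 * #|point Pi| ^ (k - 2))).
Proof.
move=> ord k2.
pose A (i : 'I_k) := [set t : k.-tuple (point Pi) |
  uniq t & tside l0 t i == tside l0 t (ordS i)].
pose C (i j : 'I_k) := [set t : k.-tuple (point Pi) |
  [&& uniq t, i != j, ordS i != j, ordS j != i & tside l0 t i == tside l0 t j]].
(* Here [2 < k] enters: a position differs from its first two cyclic successors. *)
have neqS (i : 'I_k) : ordS i != i /\ ordS (ordS i) != i.
  rewrite -!val_eqE /=; have := ltn_ord i; rewrite leq_eqVlt.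
  case/orP=> [/eqP eqk|ik]; first by rewrite eqk modnn modn_small; lia.
  rewrite (modn_small ik); move: ik; rewrite leq_eqVlt.
  by case/orP=> [/eqP eqk|ik]; rewrite ?eqk ?modnn ?(modn_small ik); lia.
have tneq (t : k.-tuple (point Pi)) i j : uniq t -> i != j -> tnth t i != tnth t j.
  by move=> /tuple_uniqP inj; rewrite (inj_eq inj).
have onA i : #|A i| <= n.+1 * #|point Pi| ^ (k - 1).
  have [n1 n2] := neqS i; have [n3 _] := neqS (ordS i).
  have := @card_tuples_on_line Pi n k l0 (A i) i (ordS i) [set ordS (ordS i)] ord.
  rewrite cards1 expn1; apply; rewrite ?inE 1?eq_sym // => t d.
  rewrite !inE => /andP[Ut /eqP eqs] /eqP ->.
  rewrite -/(tside l0 t i) eqs; apply: (line_ofP l0 _).2.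
  by apply: tneq; rewrite // eq_sym.
(* The inequalities in [C] make the ends of sides [i] and [j] disjoint, so both ends of side [j] are
   confined to the line of side [i]. *)
have onC i j : #|C i j| <= n.+1 ^ 2 * #|point Pi| ^ (k - 2).
  have [->|[t0]] := set_0Vmem (C i j); first by rewrite cards0.
  rewrite inE => /and5P[_ ij Sij Sji _].
  have [n1 _] := neqS j; have D2 : #|[set j; ordS j]| = 2.
    by rewrite cards2 eq_sym n1.
  have := @card_tuples_on_line Pi n k l0 (C i j) i (ordS i) [set j; ordS j] ord.
  rewrite D2; apply; rewrite ?inE ?negb_or.
  - by rewrite ij eq_sym.
  - by rewrite Sij (inj_eq (@ordS_inj _)).
  move=> t d; rewrite !inE => /and5P[Ut _ _ _ /eqP eqs] dj.
  rewrite -/(tside l0 t i) eqs.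
  have [] := line_ofP l0 (tneq t j (ordS j) Ut _); first by rewrite eq_sym.
  by case/orP: dj => /eqP ->.
have -> : #|point Pi| ^_ k = #|[set t : k.-tuple (point Pi) | uniq t]|.
  rewrite -(card_uniq_tuples k predT); apply: eq_card => t.
  by rewrite !inE all_predT.
have cover : [set t : k.-tuple (point Pi) | uniq t] \subset
    polygons l0 k :|: \bigcup_i A i :|: \bigcup_i \bigcup_j C i j.
  apply/subsetP=> t; rewrite !inE => Ut; rewrite Ut.
  have [//|/(uniqPn l0)[i [j [ij]]]] := boolP (uniq (sides l0 t)).
  have -> : size (sides l0 t) = k.
    case: t {Ut} => -[|p r] /= /eqP <- //.
    by rewrite size_pairmap size_rcons.
  move=> jk; have ik := ltn_trans ij jk.
  pose i' := Ordinal ik; pose j' := Ordinal jk.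
  rewrite -[i]/(val i') -[j]/(val j') !nth_sides => eqs /=.
  have ij' : i' != j' by rewrite -val_eqE neq_ltn ij.
  (* Either side may cyclically follow the other, the second case being the wrap-around; all
     remaining pairs fall under [C]. *)
  have [eqi|ni] := eqVneq (ordS i') j'.
    apply/orP; left; apply/bigcupP; exists i' => //.
    by rewrite inE Ut eqi eqs eqxx.
  have [eqj|nj] := eqVneq (ordS j') i'.
    apply/orP; left; apply/bigcupP; exists j' => //.
    by rewrite inE Ut eqj eqs eqxx.
  apply/orP; right; apply/bigcupP; exists i' => //; apply/bigcupP; exists j' => //.
  by rewrite inE Ut ij' ni nj eqs eqxx.
have le_sum (F : 'I_k -> nat) M : (forall i, F i <= M) -> \sum_i F i <= k * M.
  by move=> leF; rewrite -[X in X * M](card_ord k) -sum_nat_const; apply: leq_sum.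
apply: leq_trans (subset_leq_card cover) _.
apply: leq_trans (leq_card_setU _ _) _; apply: leq_add.
  apply: leq_trans (leq_card_setU _ _) _; rewrite leq_add2l.
  exact: leq_trans (leq_card_bigcup _) (le_sum _ _ onA).
apply: leq_trans (leq_card_bigcup _) (le_sum _ _ _) => i.
exact: leq_trans (leq_card_bigcup _) (le_sum _ _ (onC i)).
Qed.

(** * Error estimate and the lower bound *)

Lemma polygon_error_bound (k : nat) : 1 < k ->
  exists A, forall n N, 0 < n -> N = n ^ 2 + n + 1 ->
    k * (n.+1 * N ^ (k - 1)) + k * (k * (n.+1 ^ 2 * N ^ (k - 2))) <=
    k * ((n - 1) * N ^_ (k - 1)) + A * n ^ (2 * k - 2).
Proof.
case: k => [|[|m]] // _; rewrite subn1 subn2 /=.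
(* With [k = m + 2], the summands are the constants of [T1], [T2], [T3]: passing from the power to
   the falling factorial, the [2] in [n + 1 = (n - 1) + 2], and the non-adjacent sides. The powers
   of [3] come from [N <= 3 * n ^ 2]. *)
exists (m.+2 * m.+1 ^ 2 * 3 ^ m + 2 * m.+2 * 3 ^ m.+1 + 4 * m.+2 ^ 2 * 3 ^ m).
move=> n N n0 defN.
have leN : N <= 3 * n ^ 2 by rewrite defN; nia.
have powN j : N ^ j <= 3 ^ j * n ^ (2 * j).
  by rewrite expnM -expnMn; case: j => // j; rewrite leq_exp2r.
have -> : n ^ (2 * m.+2 - 2) = n ^ 2 * n ^ (2 * m).
  by rewrite -expnD; congr (_ ^ _); lia.
have ffN := leq_exp_ffact N m.
have P1 := powN m; have P2 := powN m.+1.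
have eP2 : n ^ (2 * m.+1) = n ^ 2 * n ^ (2 * m) by rewrite mulnS expnD.
rewrite eP2 in P2.
have T1 : m.+2 * ((n - 1) * N ^ m.+1) <= m.+2 * ((n - 1) * N ^_ m.+1) +
    m.+2 * m.+1 ^ 2 * 3 ^ m * (n ^ 2 * n ^ (2 * m)).
  have h : (n - 1) * N ^ m.+1 <=
      (n - 1) * N ^_ m.+1 + m.+1 ^ 2 * 3 ^ m * (n ^ 2 * n ^ (2 * m)).
    apply: leq_trans (leq_mul (leqnn _) ffN) _; rewrite mulnDr leq_add2l.
    have -> : m.+1 ^ 2 * 3 ^ m * (n ^ 2 * n ^ (2 * m)) =
      n ^ 2 * (m.+1 ^ 2 * (3 ^ m * n ^ (2 * m))) by ring.
    by apply: leq_mul; [nia | apply: leq_mul].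
  by have := leq_mul (leqnn m.+2) h; rewrite mulnDr !mulnA.
have T2 : m.+2 * (2 * N ^ m.+1) <= 2 * m.+2 * 3 ^ m.+1 * (n ^ 2 * n ^ (2 * m)).
  by rewrite mulnA (mulnC m.+2) -[X in _ <= X]mulnA leq_mul2l P2 orbT.
have T3 : m.+2 * (m.+2 * (n.+1 ^ 2 * N ^ m)) <=
    4 * m.+2 ^ 2 * 3 ^ m * (n ^ 2 * n ^ (2 * m)).
  have -> : 4 * m.+2 ^ 2 * 3 ^ m * (n ^ 2 * n ^ (2 * m)) =
    m.+2 * (m.+2 * ((4 * n ^ 2) * (3 ^ m * n ^ (2 * m)))) by ring.
  by rewrite !leq_mul2l /=; apply: leq_mul => //; nia.
have -> : m.+2 * (n.+1 * N ^ m.+1) =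
    m.+2 * ((n - 1) * N ^ m.+1) + m.+2 * (2 * N ^ m.+1).
  by rewrite -mulnDr -mulnDl; congr (_ * (_ * _)); lia.
apply: leq_trans (leq_add (leq_add T1 T2) T3) _.
move: (_ * 3 ^ m) (_ * 3 ^ m.+1) (4 * _ * _) (n ^ 2 * _) => a b c d.
by rewrite (mulnDl _ c) (mulnDl a) !addnA.
Qed.

Local Open Scope ring_scope.

Theorem theorem3 (R : realType) (k : nat) (hk : (4 <= k)%N) :
  exists a : R,
    forall (Pi : projective_plane) (n : nat), has_order Pi n -> (k <= n)%N ->
      let N := (n ^ 2 + n + 1)%N in
      (num_cycles (@levi_graph Pi) (2 * k))%:R >
        (1 / (2 * k%:R)) * (N ^_ k)%:R
        - (1 / 2) * (n%:R - 1) * (N ^_ (k - 1))%:R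
        - (k%:R - 1) * (k%:R - 2) / (2 * k%:R) * (N ^_ (k - 1))%:R
        - a * n%:R ^+ (2 * k - 2) :> R.
Proof.
have [A leA] := polygon_error_bound (ltn_trans (isT : 1 < 2)%N (ltnW hk)).
(* The extra one makes the inequality strict, since [n ^ (2 * k - 2)] is positive. *)
exists (A.+1)%:R => Pi n ord kn; cbv zeta; set N := (n ^ 2 + n + 1)%N.
have [_ [l0 _]] := ex_nonincident Pi.
have n0 : (0 < n)%N by lia.
have upper := card_uniq_tuples_polygons l0 ord (ltnW hk).
have lower := card_polygons_cycles l0 (ltnW (ltnW hk)).
have := leA n N n0 erefl; rewrite (card_points ord) -/N in upper *.
set c := num_cycles _ _ in lower *; set X := (N ^_ (k - 1))%N => err.
have main : (N ^_ k <= 2 * k * c + (k * ((n - 1) * X) + A * n ^ (2 * k - 2)))%N.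
  by apply: leq_trans upper _; rewrite -addnA; apply: leq_add.
have M0 : (0 < n ^ (2 * k - 2))%N by rewrite expn_gt0 n0.
move: main; rewrite -(ler_nat R) !natrD !natrM natrB // -natrX.
rewrite -(ltr_nat R) in M0; move: (n ^ _)%N M0 => M M0 main.
have k4 : 4 <= k%:R :> R by rewrite (ler_nat R 4).
have third : 0 <= (k%:R - 1) * (k%:R - 2) / (2 * k%:R) * X%:R :> R.
  by apply: mulr_ge0 => //; apply: divr_ge0; [apply: mulr_ge0|]; lra.
(* Dividing by [2 * k] only shrinks the error, so [A] itself serves as its coefficient. *)
have kA : 1 / (2 * k%:R) * (A%:R * M%:R) <= A%:R * M%:R :> R.
  by apply: ler_piMl; [apply: mulr_ge0 | rewrite ler_pdivrMr; lra].
have k2 : 0 <= 1 / (2 * k%:R) :> R by apply: divr_ge0; lra.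
have := ler_wpM2l k2 main.
have -> : 1 / (2 * k%:R) * (2 * k%:R * c%:R + (k%:R * ((n%:R - 1) * X%:R)
    + A%:R * M%:R)) = c%:R + 1 / 2 * (n%:R - 1) * X%:R
    + 1 / (2 * k%:R) * (A%:R * M%:R) :> R by field; lra.
by move: third kA; rewrite -(natr1 A); move: (_ / _ * X%:R) => e; lra.
Qed.
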